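(* Let $q\neq0$ be a Herglotz function. If the function $r\mapsto|q(ir)|$ or the function $r\mapsto\frac1{|q(ir)|}$ is positively increasing at infinity (in particular, if $|q(ir)|$ is regularly varying with index $\alpha\neq0$), then $\operatorname{Im}q(ir)\asymp|q(ir)|$ as $r\to\infty$.
   Context: A Herglotz function is a holomorphic function $q$ on $\mathbb C\setminus\mathbb R$ with $\frac{\operatorname{Im}q(z)}{\operatorname{Im}z}\ge0$ and $q(\overline z)=\overline{q(z)}$ for all $z\in\mathbb C\setminus\mathbb R$. A measurable function $f:(0,\infty)\to(0,\infty)$ is positively increasing (at infinity) if there is $\lambda\in(0,1)$ such that $\limsup_{r\to\infty}\frac{f(\lambda r)}{f(r)}<1$ ($f$ need not be monotone). It is regularly varying (at infinity) with index $\alpha\in\mathbb R$ if $\lim_{r\to\infty}\frac{f(\lambda r)}{f(r)}=\lambda^\alpha$ for every $\lambda>0$. $f\asymp g$ as $r\to\infty$ means that there are constants $C_1,C_2>0$ with $C_1g(r)\le f(r)\le C_2g(r)$ for all sufficiently large $r$. *)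

(* Defs.v *)
From mathcomp Require Import all_boot all_order all_algebra.
From mathcomp Require Import all_classical all_reals all_analysis.
From mathcomp Require Import complex.

Set Implicit Arguments.
Unset Strict Implicit.
Unset Printing Implicit Defensive.

Import Order.TTheory GRing.Theory Num.Theory.
Import numFieldNormedType.Exports.

Local Open Scope classical_set_scope.
Local Open Scope ring_scope.
Local Open Scope complex_scope.

(* The order and the norm of R[i] take values in R[i] itself; [`|z|] is real,
   so taking its real part loses nothing. *)
Definition modulus (R : realType) (z : R[i]) : R := complex.Re `|z|.

(* A function on C \ R is represented by a total function whose values on the
   real axis are ignored.  Derivability is over the scalar field R[i], that is,
   the increments are complex: this is complex differentiability at z. *)
Definition holomorphic_off_real (R : realType) (q : R[i] -> R[i]) : Prop :=
  forall z : R[i], complex.Im z != 0 -> derivable (q : R[i]^o -> R[i]^o) z 1.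

Definition herglotz (R : realType) (q : R[i] -> R[i]) : Prop :=
  [/\ holomorphic_off_real q,
      forall z : R[i], complex.Im z != 0 ->
        0 <= complex.Im (q z) / complex.Im z
    & forall z : R[i], complex.Im z != 0 -> q (conjc z) = conjc (q z)].

(* A measurable function (0, oo) -> (0, oo), again as a total function. *)
Definition measurable_positive (R : realType) (f : R -> R) : Prop :=
  measurable_fun (`]0, +oo[ : set R) f /\ forall r : R, 0 < r -> 0 < f r.

Definition positively_increasing (R : realType) (f : R -> R) : Prop :=
  measurable_positive f /\
  exists lam : R, [/\ 0 < lam, lam < 1
    & (limf_esup (fun r : R => (f (lam * r) / f r)%:E) +oo%R < 1)%E].

Definition regularly_varying (R : realType) (f : R -> R) (alpha : R) : Prop :=
  measurable_positive f /\
  forall lam : R, 0 < lam ->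
    f (lam * r) / f r @[r --> +oo] --> lam `^ alpha.

Definition asymp_at_infty (R : realType) (f g : R -> R) : Prop :=
  exists C1 C2 : R, [/\ 0 < C1, 0 < C2
    & \forall r \near +oo, C1 * g r <= f r /\ f r <= C2 * g r].

(* Main.v *)
Require Import Defs.
From mathcomp Require Import all_boot all_order all_algebra.
From mathcomp Require Import all_classical all_reals all_analysis.
From mathcomp Require Import complex.
From mathcomp Require Import measurable_realfun.
From mathcomp Require Import ring lra.

Set Implicit Arguments.
Unset Strict Implicit.
Unset Printing Implicit Defensive.

Import Order.TTheory GRing.Theory Num.Theory.
Import numFieldNormedType.Exports.

Local Open Scope classical_set_scope.
Local Open Scope ring_scope.
Local Open Scope complex_scope.

(** The imaginary part of a Herglotz function controls how fast the function can
    move along the imaginary axis. Indeed, a Schwarz-Pick estimate bounds the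
    derivative of [q] at [i r] by a constant times [Im (q (i r)) / r]
    ([derive_le_Im], [axis_derive]). Applied to the imaginary part itself, this is
    a Harnack inequality ([axis_Im_growth]): on the segment from [i lam r] to
    [i r] the imaginary part is at most a constant times its value at [i r].
    Integrating the derivative along the segment gives
    [|q (i r) - q (i lam r)| <= K Im (q (i r))] with [K] depending only on [lam]
    ([axis_increment]).

    If [|q (i r)|] or its inverse is positively increasing, there are [lam < 1] and
    [de > 0] such that, for large [r], the moduli at [i lam r] and at [i r] differ
    by at least [de |q (i r)|]. Hence [de |q (i r)| <= K Im (q (i r))], and the
    other inequality is trivial.

    The estimate of the derivative comes from means over circles. The theorem of
    Goursat on rectangles ([goursat_rect], proved by bisection from mere complex
    differentiability) in logarithmic polar coordinates shows that the mean over
    the unit circle of a function holomorphic in the punctured closed disc is its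
    limit at the centre ([circle_mean]). For [f] holomorphic with [Im f >= 0] this gives the
    mean of [Im f], and also the derivative at the centre as a mean of [Im f]
    against a bounded kernel, whence [|f'(0)| <= const * Im (f 0)]. *)

(** * Integrals of continuous functions over segments *)

Section SegmentIntegral.
Context {R : realType}.
Implicit Types (f g : R -> R) (a b c : R).

Definition segint g a b : R := \int[@lebesgue_measure R]_(x in `[a, b]) g x.

(** Continuity is two-sided even at the endpoints: the integrands below
    are restrictions of functions differentiable at the endpoints as well. *)
Definition cont_on g a b := forall x, a <= x <= b -> {for x, continuous g}.

Lemma cont_on_integrable g a b : cont_on g a b ->
  (@lebesgue_measure R).-integrable `[a, b] (EFin \o g).
Proof.
move=> cg; apply: continuous_compact_integrable; first exact: segment_compact.
apply: continuous_in_subspaceT => x; rewrite inE/= in_itv/= => xab.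
exact: cg.
Qed.

Lemma segint_split g a c b : a <= c -> c <= b -> cont_on g a b ->
  segint g a b = segint g a c + segint g c b.
Proof.
move=> ac cb cg; rewrite /segint.
rewrite -(@Rintegral_itv_obnd_cbnd _ c (BRight b)); last first.
  apply: (integrableS _ _ _ (cont_on_integrable cg)) => //.
  by move=> x; rewrite /= !in_itv/=; lra.
rewrite -(Rintegral_itvB (x := c) (cont_on_integrable cg)) ?bnd_simp//.
by rewrite addrC subrK.
Qed.

Lemma segintB f g a b : cont_on f a b -> cont_on g a b ->
  segint (fun x => f x - g x) a b = segint f a b - segint g a b.
Proof.
move=> cf cg; rewrite /segint RintegralB//; exact: cont_on_integrable.
Qed.

Lemma segintD f g a b : cont_on f a b -> cont_on g a b ->
  segint (fun x => f x + g x) a b = segint f a b + segint g a b.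
Proof.
move=> cf cg; rewrite /segint RintegralD//; exact: cont_on_integrable.
Qed.

Lemma segint_cst a b c : a <= b -> segint (cst c) a b = c * (b - a).
Proof.
move=> ab; rewrite /segint Rintegral_cst//.
have H : lebesgue_measure (`[a, b] : set R) = (b - a)%:E.
  rewrite lebesgue_measure_itv/= lte_fin.
  by case: ltgtP ab => // -> _; rewrite subrr.
by congr (c * _); exact: (congr1 fine H).
Qed.

Lemma cont_on_cst a b c : cont_on (cst c) a b.
Proof. by move=> x _; exact: cst_continuous. Qed.

Lemma le_segint f g a b : cont_on f a b -> cont_on g a b ->
  (forall x, a <= x <= b -> f x <= g x) -> segint f a b <= segint g a b.
Proof.
by move=> cf cg fg; apply: le_Rintegral; rewrite ?cont_on_integrable.
Qed.

Lemma segint_near g a b c e : a <= b -> cont_on g a b ->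
  (forall x, a <= x <= b -> `|g x - c| <= e) ->
  `|segint g a b - c * (b - a)| <= e * (b - a).
Proof.
move=> ab cg gc; rewrite ler_distl -mulrBl -mulrDl.
rewrite -!(segint_cst _ ab).
apply/andP; split; apply: le_segint => //; try exact: cont_on_cst;
  by move=> x /gc; rewrite ler_distl /= => /andP[].
Qed.

End SegmentIntegral.

(** * The Goursat theorem for rectangles *)

Section Bisection.
Context {R : realType}.

Lemma nested_segments (l u : nat -> R) :
  (forall n, l n <= l n.+1) -> (forall n, u n.+1 <= u n) ->
  (forall n, l n <= u n) -> exists x, forall n, l n <= x <= u n.
Proof.
move=> ln un lu.
have lm : nondecreasing_seq l by exact/nondecreasing_seqP.
have um : nonincreasing_seq u by exact/nonincreasing_seqP.
have lub m n : l m <= u n.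
  apply: (le_trans (lm _ _ (leq_maxl m n))).
  by apply: (le_trans (lu _)); apply: um; exact: leq_maxr.
exists (sup (range l)) => n; apply/andP; split.
  apply: ub_le_sup; last by exists n.
  by exists (u 0%N) => _ [m _ <-].
by apply: ge_sup; [exists (l 0%N), 0%N|move=> _ [m _ <-]].
Qed.

Lemma half_pow_small (h d : R) : 0 < d -> exists n, h / 2 ^+ n < d.
Proof.
move=> d0; exists (Num.bound (h / d)).
by rewrite ltr_pdivrMr ?exprn_gt0// mulrC -ltr_pdivrMr// upper_nthrootP.
Qed.

(** Subdivision into quarters reduces a property of rectangles to arbitrarily
    small rectangles around each point: otherwise some sequence of nested bad
    quarters would shrink to a point. *)
Lemma bisection_rect (P : R -> R -> R -> R -> Prop) (a0 b0 c0 d0 : R) :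
  a0 <= b0 -> c0 <= d0 ->
  (forall a b c d, a0 <= a -> a <= b -> b <= b0 -> c0 <= c -> c <= d ->
     d <= d0 ->
     P a ((a + b) / 2) c ((c + d) / 2) -> P ((a + b) / 2) b c ((c + d) / 2) ->
     P a ((a + b) / 2) ((c + d) / 2) d -> P ((a + b) / 2) b ((c + d) / 2) d ->
     P a b c d) ->
  (forall x y, a0 <= x <= b0 -> c0 <= y <= d0 -> exists2 e, 0 < e &
     forall a b c d, a0 <= a -> a <= x -> x <= b -> b <= b0 ->
       c0 <= c -> c <= y -> y <= d -> d <= d0 -> b - a < e -> d - c < e ->
       P a b c d) ->
  P a0 b0 c0 d0.
Proof.
move=> ab0 cd0 quarter local; apply: contrapT => nP.
pose bad (Q : (R * R) * (R * R)) := [/\ a0 <= Q.1.1, Q.1.1 <= Q.1.2, Q.1.2 <= b0,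
  c0 <= Q.2.1 & [/\ Q.2.1 <= Q.2.2, Q.2.2 <= d0 & ~ P Q.1.1 Q.1.2 Q.2.1 Q.2.2]].
pose half (I J : R * R) := [/\ I.1 <= J.1, J.2 <= I.2 & J.2 - J.1 = (I.2 - I.1) / 2].
have step Q : exists Q', bad Q -> [/\ bad Q', half Q.1 Q'.1 & half Q.2 Q'.2].
  case: (pselect (bad Q)) => [|nb]; last by exists Q.
  case: Q => -[a b] [c d] [/= aa ab bb cc [cd dd nQ]].
  apply: contrapT => /forallNP noQ; apply: nQ.
  have badE a' b' c' d' : (a' = a /\ b' = (a + b) / 2 \/ a' = (a + b) / 2 /\ b' = b) ->
      (c' = c /\ d' = (c + d) / 2 \/ c' = (c + d) / 2 /\ d' = d) -> P a' b' c' d'.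
    move=> E1 E2; apply: contrapT => nP'.
    apply: (noQ ((a', b'), (c', d'))) => _; rewrite /bad /half /=.
    by case: E1 => -[-> ->] in nP' *; case: E2 => -[-> ->] in nP' *;
      split; split=> //; try split => //; lra.
  by apply: quarter => //; apply: badE; auto.
have [nxt nxtP] := choice step.
pose Q n := iter n nxt ((a0, b0), (c0, d0)).
have badQ n : bad (Q n) by elim: n => [|n /nxtP[]//]; split.
have hQ n : half (Q n).1 (Q n.+1).1 /\ half (Q n).2 (Q n.+1).2.
  by have [_ ? ?] := nxtP _ (badQ n).
have sz1 n : (Q n).1.2 - (Q n).1.1 = (b0 - a0) / 2 ^+ n.
  elim: n => [|n IH]; first by rewrite expr0 divr1.
  by have [[_ _ ->] _] := hQ n; rewrite IH exprSr invfM mulrA.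
have sz2 n : (Q n).2.2 - (Q n).2.1 = (d0 - c0) / 2 ^+ n.
  elim: n => [|n IH]; first by rewrite expr0 divr1.
  by have [_ [_ _ ->]] := hQ n; rewrite IH exprSr invfM mulrA.
have [x xQ] : exists x, forall n, (Q n).1.1 <= x <= (Q n).1.2.
  by apply: nested_segments => n; have [[? ? _] _] := hQ n; have [] := badQ n.
have [y yQ] : exists y, forall n, (Q n).2.1 <= y <= (Q n).2.2.
  by apply: nested_segments => n; have [_ [? ? _]] := hQ n;
    have [_ _ _ _ []] := badQ n.
have [e e0 eP] := local x y (xQ 0%N) (yQ 0%N).
have [n1 n1e] := half_pow_small (b0 - a0) e0.
have [n2 n2e] := half_pow_small (d0 - c0) e0.
pose n := maxn n1 n2.
have small (h : R) m : 0 <= h -> (m <= n)%N -> h / 2 ^+ m < e -> h / 2 ^+ n < e.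
  move=> h0 mn; apply: le_lt_trans; rewrite ler_wpM2l// lef_pV2 ?posrE ?exprn_gt0//.
  by rewrite ler_eXn2l// ltr1n.
have [aQ abQ bQ cQ [cdQ dQ]] := badQ n; apply.
have /andP[? ?] := xQ n; have /andP[? ?] := yQ n.
apply: eP => //.
  by rewrite sz1; apply: small n1e; rewrite ?leq_maxl// subr_ge0.
by rewrite sz2; apply: small n2e; rewrite ?leq_maxr// subr_ge0.
Qed.

End Bisection.

Section Goursat.
Context {R : realType}.
Implicit Types (U V : R -> R -> R) (x y : R).

(** Differentiability at [(x, y)] with partial derivatives [al] and [be], written
    with the increments of the two coordinates so that it applies directly to the
    sides of a small rectangle. *)
Definition diff2 U x y (al be : R) := forall e, 0 < e -> exists2 de, 0 < de &
  forall h k, `|h| < de -> `|k| < de ->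
    `|U (x + h) (y + k) - U x y - (al * h + be * k)| <= e * (`|h| + `|k|).

Lemma lipschitz_at_cont (g : R -> R) y de K : 0 < de ->
  (forall k, `|k| < de -> `|g (y + k) - g y| <= K * `|k|) ->
  {for y, continuous g}.
Proof.
move=> de0 gK; apply/cvgrPdist_le => e e0.
have K1 : 0 < `|K| + 1 by rewrite ltr_pwDr.
near=> z.
have zde : `|z - y| < de by rewrite distrC; near: z; exact: cvgr_dist_lt.
have ze : `|z - y| <= e / (`|K| + 1).
  by rewrite distrC; near: z; apply: cvgr_dist_le => //; rewrite divr_gt0.
have := gK _ zde; rewrite (addrC y) subrK distrC => /le_trans; apply.
apply: (@le_trans _ _ ((`|K| + 1) * `|z - y|)).
  by rewrite ler_wpM2r// (le_trans (ler_norm K))// lerDl.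
by rewrite mulrC -ler_pdivlMr.
Unshelve. all: by end_near. Qed.

Lemma diff2_cont2 U x y al be : diff2 U x y al be -> {for y, continuous (U x)}.
Proof.
move=> /(_ 1 ltr01)[de de0 dU].
apply: (@lipschitz_at_cont _ _ de (`|be| + 1)) => // k kd.
have := dU 0 k; rewrite normr0 addr0 mulr0 !add0r mul1r => /(_ de0 kd) H.
rewrite -[U x _ - _](subrK (be * k)) (le_trans (ler_normD _ _))//.
by rewrite normrM mulrDl mul1r addrC lerD2l.
Qed.

Lemma diff2_cont1 U x y al be : diff2 U x y al be ->
  {for x, continuous (U^~ y)}.
Proof.
move=> /(_ 1 ltr01)[de de0 dU].
apply: (@lipschitz_at_cont _ _ de (`|al| + 1)) => // k kd.
have := dU k 0; rewrite normr0 !addr0 mulr0 addr0 mul1r => /(_ kd de0) H.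
rewrite -[U _ _ - _](subrK (al * k)) (le_trans (ler_normD _ _))//.
by rewrite normrM mulrDl mul1r addrC lerD2l.
Qed.

(** The form [V dx + U dy] is closed at every point, as [al] is both [dU/dx] and
    [dV/dy]. Its integral along the boundary is additive under quartering, and
    near a point it is negligible before the squared size of the rectangle, by
    the first-order expansions at that point. Bisection then makes it at
    most any positive multiple of the squared size of the whole rectangle. *)
Lemma goursat_rect U V (a b c d : R) : a <= b -> c <= d ->
  (forall x y, a <= x <= b -> c <= y <= d ->
    exists al be be', diff2 U x y al be /\ diff2 V x y be' al) ->
  segint (U b) c d - segint (U a) c d = segint (V^~ d) a b - segint (V^~ c) a b.
Proof.
move=> ab cd dUV.
have cU x c' d' : a <= x <= b -> c <= c' -> d' <= d -> cont_on (U x) c' d'.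
  move=> xab cc dd y /andP[cy yd].
  have [|al [be [be' [/diff2_cont2 //]]]] := dUV x y xab.
  by apply/andP; split; lra.
have cV y a' b' : c <= y <= d -> a <= a' -> b' <= b -> cont_on (V^~ y) a' b'.
  move=> ycd aa bb x /andP[ax xb].
  have xab : a <= x <= b by apply/andP; split; lra.
  by have [al [be [be' [_ /diff2_cont1]]]] := dUV x y xab ycd.
(* The integral of V dx + U dy along the boundary, counterclockwise. *)
pose T a b c d := (segint (U b) c d - segint (U a) c d) -
  (segint (V^~ d) a b - segint (V^~ c) a b).
suff T0 e : 0 < e -> `|T a b c d| <= e * ((b - a) ^+ 2 + (d - c) ^+ 2).
  apply/eqP; rewrite -subr_eq0 -normr_le0; apply/ler_addgt0Pr => e e0.
  rewrite add0r.
  set S := (b - a) ^+ 2 + (d - c) ^+ 2 in T0.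
  have S0 : 0 < S + 1 by rewrite ltr_wpDl// addr_ge0// sqr_ge0.
  have /T0/le_trans : 0 < e / (S + 1) by rewrite divr_gt0.
  apply; rewrite mulrAC ler_pdivrMr// ler_wpM2l ?ltW//; lra.
move=> e0; pose P a b c d := `|T a b c d| <= e * ((b - a) ^+ 2 + (d - c) ^+ 2).
apply: (@bisection_rect _ P) => //.
- move=> a' b' c' d'; set m := (a' + b') / 2; set n := (c' + d') / 2.
  move=> aa ab' bb cc cd' dd; rewrite /P.
  have [am mb] : a' <= m /\ m <= b' by rewrite /m; split; lra.
  have [cn nd] : c' <= n /\ n <= d' by rewrite /n; split; lra.
  have -> : T a' b' c' d' = T a' m c' n + T m b' c' n + T a' m n d' + T m b' n d'.
    rewrite /T (@segint_split _ (U b') c' n d')//; last by apply: cU; lra.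
    rewrite (@segint_split _ (U a') c' n d')//; last by apply: cU; lra.
    rewrite (@segint_split _ (V^~ c') a' m b')//; last by apply: cV; lra.
    rewrite (@segint_split _ (V^~ d') a' m b')//; last by apply: cV; lra.
    ring.
  move=> T1 T2 T3 T4.
  rewrite (le_trans (ler_normD _ _))//.
  rewrite (le_trans (lerD (ler_normD _ _) (lexx _)))//.
  rewrite (le_trans (lerD (lerD (ler_normD _ _) (lexx _)) (lexx _)))//.
  apply: (le_trans (lerD (lerD (lerD T1 T2) T3) T4)).
  rewrite le_eqVlt; apply/orP; left; apply/eqP; rewrite /m /n; by field.
- move=> x y xab ycd; have [al [be [be' [dU dV]]]] := dUV x y xab ycd.
  have e4 : 0 < e / 4 by rewrite divr_gt0.
  have [d1 d10 U1] := dU _ e4; have [d2 d20 V1] := dV _ e4.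
  exists (Num.min d1 d2) => [|a' b' c' d' aa ax xb bb cc cy yd dd].
    by rewrite lt_min d10.
  have ab' : a' <= b' by exact: le_trans xb.
  have cd' : c' <= d' by exact: le_trans yd.
  have a'ab : a <= a' <= b by rewrite aa (le_trans ab').
  have b'ab : a <= b' <= b by rewrite bb (le_trans aa).
  have c'cd : c <= c' <= d by rewrite cc (le_trans cd').
  have d'cd : c <= d' <= d by rewrite dd (le_trans cc).
  rewrite !lt_min => /andP[h1 h2] /andP[k1 k2]; rewrite /P.
  set H := b' - a'; set K := d' - c'.
  have H0 : 0 <= H by rewrite subr_ge0.
  have K0 : 0 <= K by rewrite subr_ge0.
  have absH z : a' <= z <= b' -> `|z - x| <= H.
    by move=> /andP[? ?]; rewrite ler_distl /H; apply/andP; split; lra.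
  have absK z : c' <= z <= d' -> `|z - y| <= K.
    by move=> /andP[? ?]; rewrite ler_distl /K; apply/andP; split; lra.
  have Uerr z w : a' <= z <= b' -> c' <= w <= d' ->
      `|U z w - U x y - (al * (z - x) + be * (w - y))| <= e / 4 * (H + K).
    move=> /absH zH /absK wK.
    have := U1 (z - x) (w - y) (le_lt_trans zH h1) (le_lt_trans wK k1).
    rewrite (addrC x) subrK (addrC y) subrK => /le_trans; apply.
    by apply: ler_wpM2l; [exact: ltW|exact: lerD].
  have Verr z w : a' <= z <= b' -> c' <= w <= d' ->
      `|V z w - V x y - (be' * (z - x) + al * (w - y))| <= e / 4 * (H + K).
    move=> /absH zH /absK wK.
    have := V1 (z - x) (w - y) (le_lt_trans zH h2) (le_lt_trans wK k2).
    rewrite (addrC x) subrK (addrC y) subrK => /le_trans; apply.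
    by apply: ler_wpM2l; [exact: ltW|exact: lerD].
  have aab : a' <= a' <= b' by rewrite lexx.
  have bab : a' <= b' <= b' by rewrite lexx ab'.
  have ccd : c' <= c' <= d' by rewrite lexx.
  have dcd : c' <= d' <= d' by rewrite lexx cd'.
  have IU : `|segint (fun w => U b' w - U a' w) c' d' - al * H * K| <=
      e / 2 * (H + K) * K.
    apply: segint_near => //.
      by move=> w wcd; apply: continuousB; [exact: (cU b' c' d')|
         exact: (cU a' c' d')].
    move=> w wcd; have := Uerr _ _ bab wcd; have := Uerr _ _ aab wcd.
    rewrite !ler_norml /H; clear; lra.
  have IV : `|segint (fun z => V z d' - V z c') a' b' - al * K * H| <=
      e / 2 * (H + K) * H.
    apply: segint_near => //.
      by move=> w wcd; apply: continuousB; [exact: (cV d' a' b')|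
         exact: (cV c' a' b')].
    move=> w wcd; have := Verr _ _ wcd dcd; have := Verr _ _ wcd ccd.
    rewrite !ler_norml /K; clear; lra.
  rewrite /T -segintB; [|exact: cU|exact: cU].
  rewrite -segintB; [|exact: cV|exact: cV].
  (* e / 2 * (H + K) ^ 2 <= e * (H ^ 2 + K ^ 2) *)
  have sq0 : 0 <= e / 2 * (H - K) ^+ 2 by rewrite mulr_ge0 ?sqr_ge0// ltW ?divr_gt0.
  move: IU IV sq0; rewrite !ler_norml; clear; nra.
Qed.

End Goursat.

(** * First-order expansions over the reals and over the complex numbers *)

Section Expansion.
Context {K : numFieldType}.
Implicit Types (f : K -> K) (x d : K).

(** The same definition serves the real functions of the radius and the complex
    functions of a complex variable, so that derivatives pass between the two. *)
Definition expands f x d := forall e : K, 0 < e -> exists2 de : K, 0 < de &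
  forall h, `|h| < de -> `|f (x + h) - f x - d * h| <= e * `|h|.

Lemma is_derive_expands f x d :
  is_derive (x : K^o) 1 (f : K^o -> K^o) d -> expands f x d.
Proof.
move=> -[df dE] e e0; rewrite -{}dE; set d' := derive _ _ _.
have /cvgrPdist_le/(_ e e0) :
    h^-1 *: ((f (h *: (1 : K^o) + x) : K^o) - f x) @[h --> 0^'] --> (d' : K^o).
  exact: df.
move=> /nbhs_ballP[de /= de0 H].
exists de => // h hde; have [->|h0] := eqVneq h 0.
  by rewrite addr0 subrr mulr0 subrr !normr0 mulr0.
have := H h; rewrite /ball/= sub0r normrN => /(_ hde h0).
rewrite /GRing.scale/= mulr1 => H'.
have nh0 : 0 < `|h| by rewrite normr_gt0.
have -> : f (x + h) - f x - d' * h = - ((d' - h^-1 * (f (h + x) - f x)) * h).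
  by rewrite (addrC x); field.
by rewrite normrN normrM ler_wpM2r.
Qed.

Lemma expands_derive f x d : expands f x d -> is_derive (x : K^o) 1 (f : K^o -> K^o) d.
Proof.
move=> fd.
have H : h^-1 *: ((f (h *: (1 : K^o) + x) : K^o) - f x) @[h --> 0^'] --> (d : K^o).
  apply/cvgrPdist_le => e e0; have [de de0 H] := fd e e0.
  apply/nbhs_ballP; exists de => //= h.
  rewrite /ball/= sub0r normrN => hde h0.
  have nh0 : 0 < `|h| by rewrite normr_gt0.
  have := H h hde; rewrite -ler_pdivrMr// -normfV -normrM.
  rewrite distrC /GRing.scale/= mulr1 (addrC h).
  by congr (`|_| <= _); field.
by apply: DeriveDef; [apply/cvg_ex; exists d|exact: cvg_lim H].
Qed.

End Expansion.

(** * Logarithmic polar coordinates *)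

Section Modulus.
Context {R : realType}.
Implicit Types (z w : R[i]).

Lemma normE z : `|z| = (modulus z)%:C.
Proof. by rewrite /modulus normc_def. Qed.

Lemma modulus_sqrt z :
  modulus z = Num.sqrt (complex.Re z ^+ 2 + complex.Im z ^+ 2).
Proof. by rewrite /modulus normc_def. Qed.

Lemma modulus_ge0 z : 0 <= modulus z.
Proof. by rewrite modulus_sqrt sqrtr_ge0. Qed.

Lemma modulusD z w : modulus (z + w) <= modulus z + modulus w.
Proof. by rewrite -lecR rmorphD -!normE ler_normD. Qed.

Lemma modulus_dist z w : `|modulus z - modulus w| <= modulus (z - w).
Proof.
have := modulusD (z - w) w; have := modulusD (w - z) z; rewrite !subrK.
by rewrite {2}/modulus distrC -/(modulus _) ler_norml => ? ?; lra.
Qed.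

Lemma modulus_le_ReIm z :
  modulus z <= `|complex.Re z| + `|complex.Im z|.
Proof.
rewrite modulus_sqrt -[leRHS]ger0_norm ?addr_ge0// -sqrtr_sqr.
rewrite ler_wsqrtr// sqrrD !real_normK ?num_real// -addrA [_ *+ 2 + _]addrC addrA lerDl.
by rewrite mulrn_wge0// mulr_ge0.
Qed.

Lemma normr_Re_le z : `|complex.Re z| <= modulus z.
Proof. by rewrite -sqrtr_sqr modulus_sqrt ler_wsqrtr// lerDl sqr_ge0. Qed.

Lemma normr_Im_le z : `|complex.Im z| <= modulus z.
Proof. by rewrite -sqrtr_sqr modulus_sqrt ler_wsqrtr// lerDr sqr_ge0. Qed.

Lemma modulus_eq0 z : (modulus z == 0) = (z == 0).
Proof. by rewrite -(inj_eq (@complexI R)) -normE normr_eq0. Qed.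

Lemma modulus_gt0 z : (0 < modulus z) = (z != 0).
Proof. by rewrite lt_neqAle modulus_ge0 andbT eq_sym modulus_eq0. Qed.

(** The order of the complex numbers relates only numbers with the same imaginary
    part, so a positive complex [e] is a real one. *)
Lemma expandsC (f : R[i] -> R[i]) z d : expands f z d <->
  forall e : R, 0 < e -> exists2 de : R, 0 < de &
  forall h, modulus h < de -> modulus (f (z + h) - f z - d * h) <= e * modulus h.
Proof.
split=> H e e0.
  have [|de de0 dH] := H e%:C; first by rewrite ltcR.
  have deE : de = (complex.Re de)%:C by rewrite RRe_real// gtr0_real.
  exists (complex.Re de) => [|h hd]; first by rewrite -ltcR -deE.
  by rewrite -lecR rmorphM -!normE dH// deE normE ltcR.
have eE : e = (complex.Re e)%:C by rewrite RRe_real// gtr0_real.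
have [|de de0 dH] := H (complex.Re e); first by rewrite -ltcR -eE.
exists de%:C => [|h]; first by rewrite ltcR.
by rewrite eE !normE ltcR -rmorphM lecR; exact: dH.
Qed.

(** The Cauchy-Riemann equations: [d] times a complex increment is a linear map
    of the two real increments of this particular form. *)
Lemma expands_diff2 (f : R[i] -> R[i]) (x y : R) d : expands f (x +i* y) d ->
  diff2 (fun s t => complex.Re (f (s +i* t))) x y (complex.Re d) (- complex.Im d) /\
  diff2 (fun s t => complex.Im (f (s +i* t))) x y (complex.Im d) (complex.Re d).
Proof.
move=> /expandsC fd.
have key e : 0 < e -> exists2 de, 0 < de & forall h k, `|h| < de -> `|k| < de ->
    modulus (f ((x + h) +i* (y + k)) - f (x +i* y) - d * (h +i* k)) <=
    e * (`|h| + `|k|).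
  move=> e0; have [de de0 H] := fd e e0; exists (de / 2) => [|h k hd kd].
    by rewrite divr_gt0.
  have hk := modulus_le_ReIm (h +i* k).
  have -> : (x + h) +i* (y + k) = (x +i* y) + (h +i* k) by [].
  apply: (le_trans (H _ _)); last by rewrite ler_wpM2l// ltW.
  by apply: (le_lt_trans hk); rewrite [ltRHS]splitr ltrD.
split=> e /key[de de0 H]; exists de => // h k hd kd;
  apply: le_trans (H h k hd kd).
  apply: le_trans (normr_Re_le _).
  case: (f _) => a b; case: (f _) => a' b'; case: d {fd key H} => al be /=.
  by rewrite le_eqVlt; apply/orP; left; apply/eqP; congr `|_|; ring.
apply: le_trans (normr_Im_le _).
case: (f _) => a b; case: (f _) => a' b'; case: d {fd key H} => al be /=.
by rewrite le_eqVlt; apply/orP; left; apply/eqP; congr `|_|; ring.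
Qed.

Lemma derivable_diff2 (f : R[i] -> R[i]) (x y : R) :
  derivable (f : R[i]^o -> R[i]^o) (x +i* y) 1 -> exists al be,
  diff2 (fun s t => complex.Re (f (s +i* t))) x y al (- be) /\
  diff2 (fun s t => complex.Im (f (s +i* t))) x y be al.
Proof.
move=> /derivableP/is_derive_expands/expands_diff2; set d := derive _ _ _ => fd.
by exists (complex.Re d), (complex.Im d).
Qed.

End Modulus.

Section ComplexExponential.
Context {R : realType}.

Definition expC (w : R[i]) : R[i] :=
  (expR (complex.Re w) * cos (complex.Im w)) +i*
  (expR (complex.Re w) * sin (complex.Im w)).

Lemma expCD z w : expC (z + w) = expC z * expC w.
Proof.
case: z => a b; case: w => a' b'; rewrite /expC/= expRD cosD sinD.
by apply/eqP; rewrite eq_complex/=; apply/andP; split; apply/eqP; ring.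
Qed.

Lemma modulus_expC w : modulus (expC w) = expR (complex.Re w).
Proof.
rewrite modulus_sqrt /= !exprMn -mulrDr cos2Dsin2 mulr1 sqrtr_sqr.
by rewrite ger0_norm ?expR_ge0.
Qed.

Lemma expC0 : expC 0 = 1.
Proof. by rewrite /expC/= expR0 cos0 sin0 mulr1 mulr0. Qed.

Lemma expC_expands0 : expands expC 0 1.
Proof.
apply/expandsC => e e0.
have [e3 [e30 e31 e39]] : exists e3, [/\ 0 < e3, e3 <= 1 & e3 <= e / 9].
  by exists (Num.min 1 (e / 9)); split;
    rewrite ?lt_min ?ge_min ?lexx ?ltr01 ?orbT ?divr_gt0.
have [d1 d10 H1] := is_derive_expands (is_derive_expR (0 : R)) e30.
have [d2 d20 H2] := is_derive_expands (is_derive_cos (0 : R)) e30.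
have [d3 d30 H3] := is_derive_expands (is_derive_sin (0 : R)) e30.
exists (Num.min (Num.min d1 e3) (Num.min d2 d3)) => [|h].
  by rewrite !lt_min d10 e30 d20 d30.
rewrite !lt_min => /andP[/andP[h1 he] /andP[h2 h3]].
have := H1 _ (le_lt_trans (normr_Re_le h) h1).
have := H2 _ (le_lt_trans (normr_Im_le h) h2).
have := H3 _ (le_lt_trans (normr_Im_le h) h3).
rewrite expC0 !add0r expR0 cos0 sin0 !oppr0 !mul0r !oppr0 !addr0 !mul1r.
have hr := normr_Re_le h; have hi := normr_Im_le h.
set m := modulus h in hr hi he *.
move=> S0 B0 A0; apply: le_trans (modulus_le_ReIm _) _; move: S0 B0 A0.
case: h @m hr hi he {h1 h2 h3} => a b m /= hr hi he.
set S := sin b - b; set B := cos b - 1; set A := expR a - 1 - a => S0 B0 A0.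
have -> : expR a = 1 + a + A by rewrite /A; ring.
have -> : cos b = 1 + B by rewrite /B; ring.
have -> : sin b = b + S by rewrite /S; ring.
have m0 : 0 <= m by exact: modulus_ge0.
have AA : `|a + A| <= 2 * m.
  rewrite (le_trans (ler_normD _ _))// mulr_natl mulr2n lerD//.
  by rewrite (le_trans A0)// -[leRHS]mul1r; apply: ler_pM => //; exact: ltW.
have A3 : `|1 + a + A| <= 3.
  rewrite -addrA (le_trans (ler_normD _ _))// normr1.
  by move: AA (ltW he) e31; clear; lra.
have B1 : `|B| <= e3 * m by apply: le_trans B0 _; apply: ler_wpM2l => //; exact: ltW.
have S1 : `|S| <= e3 * m by apply: le_trans S0 _; apply: ler_wpM2l => //; exact: ltW.
have A1 : `|A| <= e3 * m by apply: le_trans A0 _; apply: ler_wpM2l => //; exact: ltW.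
have T1 : `|(1 + a + A) * B| <= 3 * (e3 * m) by rewrite normrM ler_pM.
have T2 : `|(1 + a + A) * S| <= 3 * (e3 * m) by rewrite normrM ler_pM.
have T3 : `|(a + A) * b| <= 2 * (e3 * m).
  rewrite normrM [e3 * m]mulrC mulrA; apply: ler_pM => //.
  by apply: le_trans hi _; exact: ltW.
apply: (@le_trans _ _ (9 * (e3 * m))); last first.
  by rewrite mulrA ler_wpM2r// mulrC -ler_pdivlMr.
have -> : (1 + a + A) * (1 + B) - 1 - a = A + (1 + a + A) * B by ring.
have -> : (1 + a + A) * (b + S) - 0 - b = (a + A) * b + (1 + a + A) * S by ring.
have := ler_normD A ((1 + a + A) * B).
have := ler_normD ((a + A) * b) ((1 + a + A) * S).
by move: T1 T2 T3 A1; clear; lra.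
Qed.

Lemma is_derive_expC w : is_derive (w : R[i]^o) 1 (expC : R[i]^o -> R[i]^o) (expC w).
Proof.
apply: expands_derive => e e0.
have w1 : 0 < `|expC w| + 1 by rewrite ltr_wpDl.
have [de de0 H] := expC_expands0 (divr_gt0 e0 w1).
exists de => // h /H; rewrite add0r expC0 mul1r => {}H.
have -> : expC (w + h) - expC w - expC w * h = expC w * (expC h - 1 - h).
  by rewrite expCD; ring.
rewrite normrM; apply: le_trans (ler_wpM2l (normr_ge0 _) H) _.
rewrite mulrA ler_wpM2r// mulrCA; apply: ler_piMr; first exact: ltW.
by rewrite ler_pdivrMr// mul1r lerDl.
Qed.

End ComplexExponential.

(** * Mean values over the unit circle *)

Section CircleMean.
Context {R : realType}.
Local Notation C := R[i].
Local Notation cderivable g w := (derivable (g : C^o -> C^o) (w : C^o) (1 : C^o)).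

Definition circle_int (u : C -> R) : R :=
  segint (fun t => u (expC (0 +i* t))) 0 (2 * pi).

Lemma cderivable_comp (g h : C -> C) (w : C) :
  cderivable h w -> cderivable g (h w) -> cderivable (g \o h) w.
Proof.
move=> /derivable1_diffP dh /derivable1_diffP dg.
apply/derivable1_diffP.
exact: (@differentiable_comp _ C^o C^o C^o h g w dh dg).
Qed.

Lemma cderivable_expC (g : C -> C) (w : C) :
  cderivable g (expC w) -> cderivable (g \o expC) w.
Proof.
apply: cderivable_comp; by have [] := is_derive_expC w.
Qed.

Lemma periodic_expC (s : R) : expC (s +i* (2 * pi)) = expC (s +i* 0).
Proof.
rewrite /expC/= -[2 * pi]addr0; have := @cosD2pi R 0; have := @sinD2pi R 0.
by rewrite !add0r mulr_natl mulr2n addr0 => -> ->.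
Qed.

Lemma modulus_expC_bound (s t : R) : s <= 0 -> 0 < modulus (expC (s +i* t)) <= 1.
Proof. by move=> s0; rewrite modulus_expC expR_gt0 /= -expR0 ler_expR. Qed.

(** In the logarithmic coordinates [s + i t] the circles around [0] become
    vertical segments and [g] becomes [2 pi]-periodic in [t]. The horizontal sides
    of a rectangle of height [2 pi] therefore cancel in the theorem of Goursat, so
    the mean of [g] over the circle of radius [exp s] does not depend on [s <= 0];
    it tends to [L] as [s] tends to minus infinity. *)
Lemma circle_mean (g : C -> C) (L : C) :
  (forall w, 0 < modulus w <= 1 -> cderivable g w) ->
  (g : C^o -> C^o) w @[w --> (0 : C^o)^'] --> (L : C^o) ->
  circle_int (fun w => complex.Re (g w)) = complex.Re L * (2 * pi).
Proof.
move=> dg gL; have pi20 : 0 <= 2 * pi :> R by rewrite mulr_ge0// pi_ge0.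
pose U (s t : R) := complex.Re ((g \o expC) (s +i* t)).
pose V (s t : R) := complex.Im ((g \o expC) (s +i* t)).
have dUV s t : s <= 0 -> exists al be be',
    diff2 U s t al be /\ diff2 V s t be' al.
  move=> s0; have [|al [be [dU dV]]] := @derivable_diff2 _ (g \o expC) s t.
    by apply: cderivable_expC; apply: dg; exact: modulus_expC_bound.
  by exists al, (- be), be.
have Uconst s : s <= 0 -> segint (U 0) 0 (2 * pi) = segint (U s) 0 (2 * pi).
  move=> s0; apply/eqP; rewrite -subr_eq0 (@goursat_rect _ U V s 0)//.
    have -> : V^~ (2 * pi) = V^~ 0.
      by apply/funext => x; rewrite /V /= periodic_expC.
    by rewrite subrr.
  by move=> x y /andP[_ x0] _; exact: dUV.
rewrite /circle_int -[segint _ _ _]/(segint (U 0) 0 (2 * pi)).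
apply/eqP; rewrite -subr_eq0 -normr_le0; apply/ler_addgt0Pr => e e0.
rewrite add0r; pose e' := e / (2 * pi).
have pi2 : 0 < 2 * pi :> R by rewrite mulr_gt0// pi_gt0.
have e'0 : 0 < e' by rewrite divr_gt0.
have /cvgrPdist_le/(_ e'%:C) := gL; rewrite ltcR => /(_ e'0) /nbhs_ballP[de /= de0 H].
have deE : de = (complex.Re de)%:C by rewrite RRe_real// gtr0_real.
have de0' : 0 < complex.Re de by rewrite -ltcR -deE.
pose s := Num.min 0 (ln (complex.Re de) - 1).
have s0 : s <= 0 by rewrite ge_min lexx.
have sde : expR s < complex.Re de.
  rewrite -[ltRHS]lnK ?posrE// ltr_expR gt_min; apply/orP; right; lra.
rewrite (Uconst s s0) -[X in complex.Re L * X]subr0.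
have -> : e = e' * (2 * pi - 0) by rewrite subr0 divfK// gt_eqF.
apply: segint_near => // [t _|t _].
  by have [al [be [be' [/diff2_cont2]]]] := dUV s t s0.
have wE : modulus (expC (s +i* t)) = expR s by rewrite modulus_expC.
have := H (expC (s +i* t)).
rewrite /ball/= sub0r normrN normE deE ltcR wE => /(_ sde) H'.
have {H'} : `|L - g (expC (s +i* t))| <= e'%:C.
  by apply: H'; rewrite -modulus_eq0 wE gt_eqF ?expR_gt0.
rewrite distrC normE lecR; apply: le_trans; apply: le_trans (normr_Re_le _).
by rewrite /U /=; case: (g _) => a b; case: L {gL H} => a' b'.
Qed.

Lemma cont_on_circle (g : C -> C) a b : (forall w, modulus w = 1 -> cderivable g w) ->
  cont_on (fun t => complex.Re (g (expC (0 +i* t)))) a b /\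
  cont_on (fun t => complex.Im (g (expC (0 +i* t)))) a b.
Proof.
move=> dg.
have dF t : cderivable (g \o expC) (0 +i* t).
  by apply: cderivable_expC; apply: dg; rewrite modulus_expC expR0.
by split=> t _; have [al [be [dU dV]]] := derivable_diff2 (dF t);
  [exact: diff2_cont2 dU|exact: diff2_cont2 dV].
Qed.

Section HalfPlaneValued.
Variables (f : C -> C) (d : C).
Hypothesis df : forall w, modulus w <= 1 -> cderivable f w.
Hypothesis f_ge0 : forall w, modulus w <= 1 -> 0 <= complex.Im (f w).
Hypothesis fd : is_derive (0 : C^o) (1 : C^o) (f : C^o -> C^o) d.

Let f_cvg0 : (f : C^o -> C^o) w @[w --> (0 : C^o)^'] --> (f 0 : C^o).
Proof.
have /derivable1_diffP/differentiable_continuous : cderivable f 0.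
  by apply: df; rewrite /modulus normr0 ler01.
by move/continuous_withinNx.
Qed.

Lemma ReNi (z : C) : complex.Re (- 'i * z) = complex.Im z.
Proof. by case: z => a b /=; ring. Qed.

(** [Im f] is the real part of [- i f]. *)
Lemma circle_mean_Im : circle_int (fun w => complex.Im (f w)) =
  complex.Im (f 0) * (2 * pi).
Proof.
rewrite -[complex.Im (f 0)]ReNi -(@circle_mean (fun w => - 'i * f w)).
- by congr circle_int; apply/funext => w; rewrite ReNi.
- move=> w /andP[_ w1]; apply: derivableM; [exact: derivable_cst|exact: df].
- by apply: cvgM; [exact: cvg_cst|exact: f_cvg0].
Qed.

(** The mean of the right-hand side of the bound is [4 Im (f 0)] because
    [Im f] has mean [Im (f 0)]: an estimate of [g] by the values of [Im f] on the
    circle becomes an estimate by the value of [Im f] at the centre. *)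
Lemma circle_mean_le (g : C -> C) (L : C) :
  (forall w, 0 < modulus w <= 1 -> cderivable g w) ->
  (g : C^o -> C^o) w @[w --> (0 : C^o)^'] --> (L : C^o) ->
  (forall t, `|complex.Re (g (expC (0 +i* t)))| <=
     2 * (complex.Im (f (expC (0 +i* t))) + complex.Im (f 0))) ->
  `|complex.Re L| <= 4 * complex.Im (f 0).
Proof.
move=> dg gL gf; have pi2 : 0 < 2 * pi :> R by rewrite mulr_gt0// pi_gt0.
rewrite -(ler_pM2r pi2) -[X in _ * X <= _]gtr0_norm// -normrM -(circle_mean dg gL).
have mf := circle_mean_Im.
rewrite /circle_int in mf *.
set u := (fun t : R => complex.Im _) in mf; set v := (fun t : R => complex.Re _).
have cu : cont_on u 0 (2 * pi).
  by apply: (cont_on_circle _ _ _).2 => w w1; apply: df; rewrite w1.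
have cv : cont_on v 0 (2 * pi).
  by apply: (cont_on_circle _ _ _).1 => w w1; apply: dg; rewrite w1 ltr01 lexx.
have c0 : cont_on (cst (complex.Im (f 0))) 0 (2 * pi) by exact: cont_on_cst.
pose p t := u t + cst (complex.Im (f 0)) t.
have cp : cont_on p 0 (2 * pi) by move=> t t02; apply: continuousD; [exact: cu|exact: c0].
have c2p : cont_on (fun t => p t + p t) 0 (2 * pi).
  by move=> t t02; apply: continuousD; exact: cp.
have ip : segint p 0 (2 * pi) = 2 * complex.Im (f 0) * (2 * pi).
  by rewrite segintD// mf segint_cst ?ltW//; ring.
have i2p : segint (fun t => p t + p t) 0 (2 * pi) = 4 * complex.Im (f 0) * (2 * pi).
  by rewrite segintD// ip; ring.
rewrite ler_norml -i2p; apply/andP; split; last first.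
  apply: le_segint => // t _; have := gf t; rewrite /= ler_norml => /andP[_].
  by rewrite mulr_natl mulr2n.
rewrite -subr_ge0 opprK -segintD//.
apply: (@le_trans _ _ (segint (cst (0 : R)) 0 (2 * pi))).
  by rewrite segint_cst ?mul0r// ltW.
apply: le_segint; first exact: cont_on_cst.
  by move=> t t02; apply: continuousD; [exact: cv|exact: c2p].
move=> t _; have := gf t; rewrite /= ler_norml => /andP[+ _].
by rewrite mulr_natl mulr2n -subr_ge0 opprK.
Qed.

Let kernel k c (w : C) : C := k * ((f w - f 0) * (w^-1 + c * w)).

Let derivable_kernel k c w : 0 < modulus w <= 1 -> cderivable (kernel k c) w.
Proof.
move=> /andP[w0 w1]; apply: derivableM; first exact: derivable_cst.
apply: derivableM.
  apply: derivableB; [exact: df|exact: derivable_cst].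
apply: derivableD; last by apply: derivableM; [exact: derivable_cst|exact: derivable_id].
by apply: derivableV; [rewrite -modulus_gt0|exact: derivable_id].
Qed.

Let kernel_cvg k c :
  (kernel k c : C^o -> C^o) w @[w --> (0 : C^o)^'] --> (k * d : C^o).
Proof.
rewrite /kernel; apply: cvgM; first exact: cvg_cst.
have H1 : ((f w - f 0) * w^-1 : C^o) @[w --> (0 : C^o)^'] --> (d : C^o).
  have [fd1 <-] := fd; have := fd1; rewrite /derivable => fd2.
  apply: cvg_trans fd2; apply: near_eq_cvg; near=> w.
  by rewrite /GRing.scale/= mulr1 addr0 mulrC.
have H2 : ((f w - f 0) * (c * w) : C^o) @[w --> (0 : C^o)^'] -->
    ((f 0 - f 0) * (c * 0) : C^o).
  apply: cvgM; first by apply: cvgB; [exact: f_cvg0|exact: cvg_cst].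
  by apply: cvgM; [exact: cvg_cst|exact: nbhs_dnbhs].
have H3 := @cvgD _ _ _ _ _ _ _ _ _ H1 H2.
rewrite mulr0 mulr0 addr0 in H3.
have -> : (fun w => (f w - f 0) * (w^-1 + c * w)) =
    (fun w => (f w - f 0) * w^-1 + (f w - f 0) * (c * w)).
  by apply/funext => w; rewrite mulrDr.
exact: H3.
Unshelve. all: by end_near. Qed.

(** A Schwarz-Pick estimate, with a worse constant. The functions
    [(f w - f 0) (w^-1 + w)] and [(f w - f 0) (w^-1 - w)] tend to the derivative [d]
    at [0]. On the unit circle the second factors are [2 cos t] and
    [- 2 i sin t], so the imaginary part of the first function and the real part of
    the second involve only [Im f - Im (f 0)], which is at most
    [Im f + Im (f 0)] in absolute value as [Im f] is nonnegative. *)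
Lemma derive_le_Im : `|complex.Re d| <= 4 * complex.Im (f 0) /\
  `|complex.Im d| <= 4 * complex.Im (f 0).
Proof.
have E1 (t : R) : modulus (expC (0 +i* t)) = 1 by rewrite modulus_expC expR0.
have bound (t a : R) : `|a| <= 1 ->
    `|2 * a * (complex.Im (f (expC (0 +i* t))) - complex.Im (f 0))| <=
    2 * (complex.Im (f (expC (0 +i* t))) + complex.Im (f 0)).
  move=> a1; set w := expC _; rewrite -mulrA normrM ger0_norm// ler_wpM2l// normrM.
  rewrite -[leRHS]mul1r ler_pM//.
  have := @f_ge0 w; have := @f_ge0 0; rewrite E1 lexx /modulus normr0 ler01.
  by move=> /(_ isT) ? /(_ isT) ?; rewrite ler_norml; lra.
have Einv (t : R) : (expC (0 +i* t))^-1 = expC (0 +i* (- t)).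
  apply: (mulIf (_ : expC (0 +i* t) != 0)).
    by rewrite -modulus_gt0 E1.
  rewrite mulVf -?modulus_gt0 ?E1//.
  by rewrite -expCD -expC0; congr expC; apply/eqP; rewrite eq_complex/= addr0 addNr !eqxx.
split.
  rewrite -[d]mul1r.
  apply: (circle_mean_le (@derivable_kernel 1 (-1)) (@kernel_cvg 1 (-1))).
  move=> t; have := bound t (sin t) (sin_max t).
  congr (`|_| <= _); rewrite /kernel Einv /expC /= !expR0 cosN sinN.
  by case: (f _) => a b; case: (f _) => a' b' /=; ring.
rewrite -ReNi.
apply: (circle_mean_le (@derivable_kernel (- 'i) 1) (@kernel_cvg (- 'i) 1)).
move=> t; have := bound t (cos t) (cos_max t).
congr (`|_| <= _); rewrite /kernel Einv /expC /= !expR0 cosN sinN.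
by case: (f _) => a b; case: (f _) => a' b' /=; ring.
Qed.

End HalfPlaneValued.

End CircleMean.

(** * Herglotz functions along the imaginary axis *)

Section Axis.
Context {R : realType}.
Variable q : R[i] -> R[i].
Hypothesis hq : herglotz q.
Let x (r : R) : R := complex.Re (q (0 +i* r)).
Let y (r : R) : R := complex.Im (q (0 +i* r)).

Lemma herglotz_Im_ge0 (z : R[i]) : 0 < complex.Im z -> 0 <= complex.Im (q z).
Proof.
move=> z0; have [_ Hq _] := hq.
have := Hq z; rewrite gt_eqF// => /(_ isT).
by rewrite pmulr_lge0// invr_gt0.
Qed.

(** The disc of centre [i r] and radius [r / 2] lies well inside the upper
    half-plane; rescaled to the unit disc, it bounds the derivative of [q] at
    [i r] by a multiple of [Im (q (i r)) / r]. *)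
Lemma axis_derive (r : R) : 0 < r -> exists dx dy : R,
  [/\ is_derive r 1 x dx, is_derive r 1 y dy,
      `|dx| <= 8 * y r / r & `|dy| <= 8 * y r / r].
Proof.
move=> r0; have [holq _ _] := hq.
pose aff (w : R[i]) : R[i] := 0 +i* r + (r / 2)%:C * w.
have Im_aff w : complex.Im (aff w) = r + r / 2 * complex.Im w.
  by case: w => a b; rewrite /aff /=; ring.
have Im_aff_gt0 w : modulus w <= 1 -> 0 < complex.Im (aff w).
  move=> w1; rewrite Im_aff.
  have := le_trans (normr_Im_le w) w1; rewrite ler_norml => /andP[w1' _].
  rewrite -[X in X + _]divr1 -mulrA -mulrDr mulr_gt0//; lra.
pose f := q \o aff.
have df w : modulus w <= 1 -> derivable (f : R[i]^o -> R[i]^o) w 1.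
  move=> w1; apply: cderivable_comp; last by apply: holq; rewrite gt_eqF// Im_aff_gt0.
  apply: derivableD; first exact: derivable_cst.
  by apply: derivableM; [exact: derivable_cst|exact: derivable_id].
have f_ge0 w : modulus w <= 1 -> 0 <= complex.Im (f w).
  by move=> w1; apply: herglotz_Im_ge0; exact: Im_aff_gt0.
have m0 : modulus (0 : R[i]) <= 1 by rewrite /modulus normr0.
have /derivableP := df _ m0; set d := derive _ _ _ => fd.
have [Red Imd] := derive_le_Im df f_ge0 fd.
have fE (a : R) : f (0 +i* (2 * a / r)) = q (0 +i* (r + a)).
  rewrite /f /= /aff; congr q; apply/eqP; rewrite eq_complex/=; apply/andP; split.
    by apply/eqP; ring.
  by apply/eqP; field; rewrite gt_eqF.
have f0E : f 0 = q (0 +i* r) by rewrite -[r in RHS]addr0 -fE mulr0 mul0r.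
have key e : 0 < e -> exists2 de, 0 < de & forall a : R, `|a| < de ->
    modulus (q (0 +i* (r + a)) - q (0 +i* r) - d * (0 +i* (2 * a / r))) <= e * `|a|.
  move=> e0; have /expandsC := is_derive_expands fd.
  have er0 : 0 < e * r / 2 by rewrite divr_gt0// mulr_gt0.
  move=> /(_ _ er0)[de de0 H]; exists (de * r / 2) => [|a ad].
    by rewrite divr_gt0// mulr_gt0.
  have wE : modulus (0 +i* (2 * a / r)) = 2 * `|a| / r.
    rewrite modulus_sqrt/= expr0n add0r sqrtr_sqr !normrM normfV.
    by rewrite normr_nat (gtr0_norm r0).
  have := H (0 +i* (2 * a / r)); rewrite wE add0r fE f0E.
  have -> : e * r / 2 * (2 * `|a| / r) = e * `|a| by field; rewrite gt_eqF.
  apply; rewrite ltr_pdivrMr// mulrC -ltr_pdivlMr//.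
exists (- 2 * complex.Im d / r), (2 * complex.Re d / r); split.
- apply: expands_derive => e /key[de de0 H]; exists de => // a /H.
  apply: le_trans; apply: le_trans (normr_Re_le _).
  rewrite /x; case: (q _) => ? ?; case: (q _) => ? ?; case: (d) => ? ? /=.
  by rewrite le_eqVlt; apply/orP; left; apply/eqP; congr `|_|; ring.
- apply: expands_derive => e /key[de de0 H]; exists de => // a /H.
  apply: le_trans; apply: le_trans (normr_Im_le _).
  rewrite /y; case: (q _) => ? ?; case: (q _) => ? ?; case: (d) => ? ? /=.
  by rewrite le_eqVlt; apply/orP; left; apply/eqP; congr `|_|; ring.
- rewrite !normrM normfV (gtr0_norm r0) normrN normr_nat ler_pM2r ?invr_gt0//.
  by move: Imd; rewrite f0E /y; lra.
- rewrite !normrM normfV (gtr0_norm r0) normr_nat ler_pM2r ?invr_gt0//.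
  by move: Red; rewrite f0E /y; lra.
Qed.

Lemma continuous_within_pos (g : R -> R) (s r : R) : 0 < s ->
  (forall t : R, 0 < t -> derivable g t 1) ->
  {within `[s, r], continuous g}.
Proof.
move=> s0 dg; apply: continuous_in_subspaceT => t; rewrite inE/= in_itv/= => /andP[st _].
apply: differentiable_continuous; apply/derivable1_diffP; apply: dg.
exact: lt_le_trans st.
Qed.

(** A Harnack inequality: the logarithmic derivative of [Im (q (i r))] is at least
    [- 8 / r]. *)
Lemma axis_Im_growth (s r : R) : 0 < s -> s <= r -> y s * s ^+ 8 <= y r * r ^+ 8.
Proof.
move=> s0 sr; pose g t := y t * t ^+ 8.
have dg (t : R) : 0 < t -> exists2 dt : R, is_derive t 1 g dt & 0 <= dt.
  move=> t0; have [_ [dy [_ ydy _ hdy]]] := axis_derive t0.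
  have tX : is_derive t 1 (fun t : R => t ^+ 8) (8 * t ^+ 7).
    by apply: DeriveDef; [exact: exprn_derivable|rewrite exp_derive [LHS]mulr1].
  exists (y t *: (8 * t ^+ 7) + t ^+ 8 *: dy).
    exact: is_deriveM ydy tX.
  rewrite /GRing.scale/=.
  have -> : y t * (8 * t ^+ 7) + t ^+ 8 * dy = t ^+ 8 * (8 * y t / t + dy).
    by field; rewrite gt_eqF.
  apply: mulr_ge0; first by rewrite exprn_ge0// ltW.
  by move: hdy; rewrite ler_norml => /andP[+ _]; rewrite -subr_ge0 opprK addrC.
have dg' (t : R) : 0 < t -> derivable g t 1 by move=> /dg[dt []].
have := @ger0_derive1_ndecr R g s r _ _ (continuous_within_pos s0 dg').
apply => // t; rewrite in_itv/= => /andP[st _]; have t0 := lt_trans s0 st.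
  exact: dg'.
by have [dt [_ <-] ?] := dg t t0; rewrite derive1E.
Qed.

(** By [axis_derive] the speed of [q] at [i t] is at most a multiple of
    [Im (q (i t)) / t], and by [axis_Im_growth] all these values are controlled by
    the one at the end [r]. *)
Lemma axis_increment (lam r : R) : 0 < lam -> lam < 1 -> 0 < r ->
  modulus (q (0 +i* r) - q (0 +i* (lam * r))) <= 16 / lam ^+ 9 * y r.
Proof.
move=> l0 l1 r0; have lr0 : 0 < lam * r by rewrite mulr_gt0.
have lrr : lam * r <= r by rewrite ler_piMl// ltW.
have y0 t : 0 < t -> 0 <= y t by move=> t0; exact: herglotz_Im_ge0.
have slope t : t \in `[lam * r, r] -> 8 * y t / t <= 8 / lam ^+ 9 * y r / r.
  rewrite in_itv/= => /andP[lt tr]; have t0 := lt_le_trans lr0 lt.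
  have yt : y t <= y r / lam ^+ 8.
    rewrite ler_pdivlMr ?exprn_gt0// -(ler_pM2r (exprn_gt0 8 r0)) -mulrA -exprMn.
    apply: le_trans (axis_Im_growth t0 tr).
    by apply: ler_wpM2l; [exact: y0|apply: lerXn2r => //; rewrite nnegrE ltW].
  rewrite -!mulrA ler_wpM2l//.
  apply: (@le_trans _ _ (y r / lam ^+ 8 / (lam * r))).
    by apply: ler_pM => //; [exact: y0|rewrite invr_ge0 ltW|rewrite lef_pV2 ?posrE].
  by rewrite le_eqVlt; apply/orP; left; apply/eqP; field; rewrite !gt_eqF.
have incr (g : R -> R) : (forall t : R, 0 < t ->
    exists2 dt : R, is_derive t 1 g dt & `|dt| <= 8 * y t / t) ->
    `|g r - g (lam * r)| <= 8 / lam ^+ 9 * y r.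
  move=> dg; have dg' (t : R) : 0 < t -> derivable g t 1 by move=> /dg[dt []].
  have isd (t : R) : t \in `]lam * r, r[ -> is_derive t 1 g ('D_1 g t).
    rewrite in_itv/= => /andP[lt _]; apply/derivableP/dg'; exact: lt_trans lt.
  have [t tlr ->] := MVT_segment lrr isd (continuous_within_pos lr0 dg').
  have t0 : 0 < t.
    by move: tlr; rewrite in_itv/= => /andP[? _]; exact: lt_le_trans lr0 _.
  have [dt [_ ->] dtle] := dg t t0.
  have S0 : 0 <= r - lam * r by rewrite subr_ge0.
  rewrite normrM (ger0_norm S0).
  apply: (@le_trans _ _ (8 / lam ^+ 9 * y r / r * r)); last by rewrite divfK// gt_eqF.
  apply: ler_pM => //; first by apply: le_trans dtle _; exact: slope.
  by rewrite gerBl ltW.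
apply: le_trans (modulus_le_ReIm _) _.
have -> : 16 / lam ^+ 9 * y r = 8 / lam ^+ 9 * y r + 8 / lam ^+ 9 * y r by ring.
apply: lerD.
  have -> : complex.Re (q (0 +i* r) - q (0 +i* (lam * r))) = x r - x (lam * r).
    by rewrite /x; case: (q _) => ? ?; case: (q _).
  by apply: incr => t /axis_derive[dx [dy [? ? ? ?]]]; exists dx.
have -> : complex.Im (q (0 +i* r) - q (0 +i* (lam * r))) = y r - y (lam * r).
  by rewrite /y; case: (q _) => ? ?; case: (q _).
by apply: incr => t /axis_derive[dx [dy [? ? ? ?]]]; exists dy.
Qed.

End Axis.

(** * Positive increase and regular variation *)

Section PositiveIncrease.
Context {R : realType}.

Lemma limf_esup_lt1P (g : R -> R) :
  (limf_esup (fun r => (g r)%:E) +oo%R < 1)%E <->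
  exists2 c : R, c < 1 & \forall r \near +oo, g r <= c.
Proof.
rewrite limf_esupE; split=> [/ereal_inf_lt[_ [V FV <-] V1]|[c c1 Fc]].
  have [c c1 Vc] : exists2 c : R, c < 1 &
      (ereal_sup [set (g r)%:E | r in V] <= c%:E)%E.
    case: (ereal_sup _) V1 => [c|//|_]; first by rewrite lte_fin; exists c.
    by exists 0; rewrite ?ltr01 ?leNye.
  exists c => //; apply: filterS FV => r Vr; rewrite -lee_fin.
  by apply: le_trans Vc; apply: ereal_sup_ubound; exists r.
apply: (@le_lt_trans _ _ c%:E); last by rewrite lte_fin.
apply: (@le_trans _ _ (ereal_sup [set (g r)%:E | r in [set r | g r <= c]])).
  by apply: ereal_inf_lbound; exists [set r | g r <= c].
by apply: ge_ereal_sup => _ [r rc <-]; rewrite lee_fin.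
Qed.

Lemma ratio_cvg_positively_increasing (f : R -> R) (lam l : R) :
  measurable_positive f -> 0 < lam -> lam < 1 -> l < 1 ->
  f (lam * r) / f r @[r --> +oo] --> l -> positively_increasing f.
Proof.
move=> mf l0 l1 ll cvl; split=> //; exists lam; split=> //.
apply/limf_esup_lt1P; exists ((l + 1) / 2); first by lra.
have e0 : 0 < (1 - l) / 2 by lra.
have /cvgrPdist_le/(_ _ e0) := cvl; apply: filterS => r.
by rewrite distrC ler_norml => /andP[_]; lra.
Qed.

Lemma measurable_positiveV (f : R -> R) :
  measurable_positive f -> measurable_positive (fun r => 1 / f r).
Proof.
move=> [mf f0]; split => [|r /f0 fr]; last by rewrite divr_gt0.
apply: (@eq_measurable_fun _ _ _ _ _ (fun r => f r `^ (-1))).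
  move=> r; rewrite inE/= in_itv/= andbT => /f0 fr.
  by rewrite powR_inv1 ?div1r// ltW.
exact: measurableT_comp (measurable_powR _) mf.
Qed.

(** The ratio of [f (r / 2)] to [f r] tends to [(1 / 2) ^ alpha], which is less
    than [1] for positive [alpha]; for negative [alpha] its inverse is. *)
Lemma regularly_varying_positively_increasing (f : R -> R) alpha :
  alpha != 0 -> regularly_varying f alpha ->
  positively_increasing f \/ positively_increasing (fun r => 1 / f r).
Proof.
move=> a0 [mf fv]; have h0 : 0 < 2^-1 :> R by rewrite invr_gt0.
have h1 : 2^-1 < 1 :> R by lra.
have := fv _ h0 => cv.
have powE : 2^-1 `^ alpha = expR (alpha * ln (2^-1 : R)).
  by rewrite /powR gt_eqF.
have ln0 : ln (2^-1 : R) < 0 by rewrite ln_lt0// h0.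
case: (ltgtP alpha 0) a0 => // a0 _; [right|left].
  apply: (@ratio_cvg_positively_increasing _ _ (2^-1 `^ alpha)^-1
    (measurable_positiveV mf) h0 h1).
    by rewrite powE -expRN expR_lt1 oppr_lt0 nmulr_rgt0.
  have cvV : (f (2^-1 * r) / f r)^-1 @[r --> +oo%R] --> (2^-1 `^ alpha)^-1.
    by apply: cvgV => //; rewrite powE gt_eqF// expR_gt0.
  apply: cvg_trans cvV; apply: near_eq_cvg; near=> r.
  by rewrite invfM invrK !div1r invrK mulrC.
apply: (ratio_cvg_positively_increasing mf h0 h1 _ cv).
by rewrite powE expR_lt1 nmulr_llt0.
Unshelve. all: by end_near. Qed.

End PositiveIncrease.

(** * Imaginary part and modulus along the imaginary axis *)

Theorem theorem4p3p1 (R : realType) (q : R[i] -> R[i])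
    (hq : herglotz q)
    (q_neq0 : exists z : R[i], complex.Im z != 0 /\ q z != 0) :
  (positively_increasing (fun r : R => modulus (q (0 +i* r))) \/
   positively_increasing (fun r : R => 1 / modulus (q (0 +i* r))) ->
   asymp_at_infty (fun r : R => complex.Im (q (0 +i* r)))
                  (fun r : R => modulus (q (0 +i* r))))
  /\
  (forall alpha : R, alpha != 0 ->
   regularly_varying (fun r : R => modulus (q (0 +i* r))) alpha ->
   (positively_increasing (fun r : R => modulus (q (0 +i* r))) \/
    positively_increasing (fun r : R => 1 / modulus (q (0 +i* r)))) /\
   asymp_at_infty (fun r : R => complex.Im (q (0 +i* r)))
                  (fun r : R => modulus (q (0 +i* r)))).
Proof.
set A := fun r : R => modulus (q (0 +i* r)).
suff main : positively_increasing A \/ positively_increasing (fun r => 1 / A r) ->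
    asymp_at_infty (fun r : R => complex.Im (q (0 +i* r))) A.
  split=> // alpha a0 /(regularly_varying_positively_increasing a0) pinc.
  by split=> //; exact: main.
(* Either kind of positive increase changes the modulus between lam r and r by a
   fixed proportion of its value at r, which only a large imaginary part allows. *)
suff key : positively_increasing A \/ positively_increasing (fun r => 1 / A r) ->
    exists lam de : R, [/\ 0 < lam, lam < 1, 0 < de &
      \forall r \near +oo, de * A r <= `|A r - A (lam * r)|].
  move=> /key[lam [de [l0 l1 de0 H]]].
  pose K : R := 16 / lam ^+ 9; have K0 : 0 < K by rewrite /K divr_gt0 ?exprn_gt0.
  exists (de / K), 1; split; [exact: divr_gt0|exact: ltr01|].
  near=> r; have r0 : 0 < r by near: r; exact: nbhs_pinfty_gt.
  split; last by rewrite mul1r (le_trans (ler_norm _))// normr_Im_le.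
  rewrite mulrAC ler_pdivrMr// mulrC [leRHS]mulrC.
  have := axis_increment hq l0 l1 r0; apply: le_trans.
  apply: (@le_trans _ _ `|A r - A (lam * r)|); last first.
    exact: modulus_dist.
  by rewrite mulrC; near: r.
case=> -[[mA A0] [lam [l0 l1 /limf_esup_lt1P[c c1 H]]]].
  exists lam, (1 - c); rewrite subr_gt0; split=> //.
  near=> r; have r0 : 0 < r by near: r; exact: nbhs_pinfty_gt.
  have : A (lam * r) / A r <= c by near: r.
  rewrite ler_pdivrMr ?A0// => Hr; rewrite (le_trans _ (ler_norm _))//; lra.
exists lam, (1 - c); rewrite subr_gt0; split=> //.
near=> r; have r0 : 0 < r by near: r; exact: nbhs_pinfty_gt.
have pA s : 0 < s -> 0 < A s.
  by move=> /A0; rewrite div1r invr_gt0.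
have Ar := pA r r0; have Alr := pA (lam * r) (mulr_gt0 l0 r0).
have : 1 / A (lam * r) / (1 / A r) <= c by near: r.
rewrite !div1r invrK ler_pdivrMl// => Hr.
rewrite distrC (le_trans _ (ler_norm _))//.
(* With B the modulus at lam r, the bounds A r <= c B and c (2 - c) <= 1 give
   (2 - c) A r <= B. *)
have sq : 0 <= (1 - c) ^+ 2 * A (lam * r) by rewrite mulr_ge0 ?sqr_ge0// ltW.
have : (2 - c) * A r <= (2 - c) * (A (lam * r) * c) by rewrite ler_wpM2l//; lra.
by move: sq; clear; lra.
Unshelve. all: by end_near. Qed.
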